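(* Let $\theta\in\mathbb{R}$, $n\ge 3$, and $p(z)=z^n+e^{i\theta}z$. Then $|p|_0=d(p)$, $|p|_\zeta<d(p)$ for every $\zeta\in Z(p)\setminus\{0\}$, and $p$ is linearly inextensible.
   Context: $S_n$ is the set of monic complex polynomials of degree $n$ with all zeros in the closed unit disk, and $Z(p)$ denotes the zero set of $p$. For $\alpha\in\mathbb{C}$, $|p|_\alpha=\min_{w\in Z(p')}|\alpha-w|$, and $d(p)=\max_{z\in Z(p)}|p|_z$. For monic $p(z)=\prod_{i=1}^n(z-z_i)$ and $q(z)=\prod_{i=1}^n(z-\zeta_i)$, $\Delta(p,q)=\min_{\sigma\in\Sigma_n}\max_{1\le i\le n}|z_i-\zeta_{\sigma(i)}|$, where $\Sigma_n$ is the symmetric group. A polynomial $p\in S_n$ is linearly inextensible if there exist $\varepsilon>0$ and constants $C\ge 0$, $\kappa>0$ depending only on $p$ such that $d(q)\le d(p)+C\,\Delta(q,p)^{1+\kappa}$ for all $q\in S_n$ with $\Delta(q,p)<\varepsilon$. *)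

(* Defs.v *)
(* The real numbers are an arbitrary R : realType, the complex numbers R[i]. *)
From mathcomp Require Export all_boot all_order all_algebra all_fingroup.
From mathcomp Require Export reals exp trigo complex.

Set Implicit Arguments.
Unset Strict Implicit.
Unset Printing Implicit Defensive.

Import Order.TTheory GRing.Theory Num.Theory.
Local Open Scope ring_scope.

(* The library's norm on R[i] takes values in R[i]; this one is real-valued. *)
Definition cabs (R : realType) (z : R[i]) : R := Normc.normc z.

(* Zeros of p listed with multiplicity, in an unspecified order, so that
   p = lead_coef p *: \prod_(z <- roots p) ('X - z%:P).
   Only meaningful for p != 0. *)
Definition roots (R : realType) (p : {poly R[i]}) : seq R[i] :=
  sval (closed_field_poly_normal p).

(* Minimum of a nonempty sequence: the default value of the iterated minimum
   is its first item (an empty sequence yields 0). *)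
Definition minseq (R : realType) (s : seq R) : R :=
  \big[Num.min/head 0 s]_(x <- s) x.

Definition inS (R : realType) (n : nat) (p : {poly R[i]}) : Prop :=
  [/\ p \is monic, size p = n.+1 & forall z, root p z -> cabs z <= 1].

(* |p|_a *)
Definition crit_dist (R : realType) (p : {poly R[i]}) (a : R[i]) : R :=
  minseq [seq cabs (a - w) | w <- roots p^`()].

(* d(p); the default 0 is harmless because crit_dist is nonnegative. *)
Definition max_crit_dist (R : realType) (p : {poly R[i]}) : R :=
  \big[Num.max/0]_(z <- roots p) crit_dist p z.

(* Delta(p, q) for p and q of degree n; independent of the order in which
   [roots] lists the zeros. *)
Definition Delta (R : realType) (n : nat) (p q : {poly R[i]}) : R :=
  minseq [seq \big[Num.max/0]_(i < n) cabs ((roots p)`_i - (roots q)`_(s i))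
         | s : 'S_n].

Definition linearly_inextensible
    (R : realType) (n : nat) (p : {poly R[i]}) : Prop :=
  inS n p /\
  exists eps C kappa : R,
    [/\ 0 < eps, 0 <= C, 0 < kappa &
      forall q : {poly R[i]}, inS n q -> Delta n q p < eps ->
        max_crit_dist q <= max_crit_dist p + C * Delta n q p `^ (1 + kappa)].

(* Main.v *)
(* Write p = z^n + c z with |c| = 1 and r = |p|_0, so that n r^(n-1) = 1; the
   critical points of p are the points r zeta, for zeta a nonzero zero, and
   r > 1/2 because n >= 3, whence |p|_zeta <= 1 - r < r.
   For q in S_n the product of the distances from a to the critical points of
   q is |q'(a)| / n, hence n |q|_a^(n-1) <= |q'(a)|.  At the zero a of q close
   to 0, |q'(a)| is the product of the distances from a to the other zeros of
   q; as the zeros of p add up to 0, this product has no first order term and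
   |q|_a <= r + O(Delta(q, p)^2).  At the zero of q close to zeta <> 0, the
   same inequality applied to a = r zeta, where q' is close to p'(a) = 0, gives
   a critical point of q close to r zeta. *)
Require Import Defs.
From mathcomp Require Import ring lra.

Set Implicit Arguments.
Unset Strict Implicit.
Unset Printing Implicit Defensive.

Import Order.TTheory GRing.Theory Num.Theory.
Local Open Scope ring_scope.

(** * The real-valued modulus *)

Lemma cabs_ge0 (R : realType) (z : R[i]) : 0 <= cabs z.
Proof. by case: z => a b; exact: sqrtr_ge0. Qed.

Lemma cabs_eq0 (R : realType) (z : R[i]) : (cabs z == 0) = (z == 0).
Proof.
by apply/eqP/eqP => [/Normc.eq0_normc|->] //; exact: Normc.normc0.
Qed.

Lemma cabsM (R : realType) (x y : R[i]) : cabs (x * y) = cabs x * cabs y.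
Proof. exact: Normc.normcM. Qed.

Lemma cabsN (R : realType) (x : R[i]) : cabs (- x) = cabs x.
Proof. exact: normcN. Qed.

Lemma cabsD_le (R : realType) (x y : R[i]) : cabs (x + y) <= cabs x + cabs y.
Proof. exact: le_normcD. Qed.

Lemma cabsB_le (R : realType) (x y : R[i]) : cabs (x - y) <= cabs x + cabs y.
Proof. by rewrite -(cabsN y) cabsD_le. Qed.

Lemma cabs_dist_trans (R : realType) (y x z : R[i]) :
  cabs (x - z) <= cabs (x - y) + cabs (y - z).
Proof. by rewrite -(subrKA y) cabsD_le. Qed.

Lemma cabs1 (R : realType) : cabs (1 : R[i]) = 1.
Proof. exact: Normc.normc1. Qed.

Lemma cabs_real (R : realType) (x : R) : cabs (x%:C)%C = `|x|.
Proof. by rewrite /cabs /= expr0n addr0 sqrtr_sqr. Qed.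

Lemma cabs_nat (R : realType) (n : nat) : cabs (n%:R : R[i]) = n%:R.
Proof. by rewrite /cabs normcMn Normc.normc1. Qed.

Lemma cabs_prod (R : realType) (I : Type) (r : seq I) (P : pred I)
    (F : I -> R[i]) :
  cabs (\prod_(i <- r | P i) F i) = \prod_(i <- r | P i) cabs (F i).
Proof. exact: (big_morph _ (@cabsM R) (cabs1 R)). Qed.

Lemma cabsX (R : realType) (x : R[i]) (n : nat) : cabs (x ^+ n) = cabs x ^+ n.
Proof. by rewrite -[n]card_ord -!prodr_const cabs_prod. Qed.

Lemma sqr_cabs (R : realType) (z : R[i]) :
  cabs z ^+ 2 = complex.Re z ^+ 2 + complex.Im z ^+ 2.
Proof. by case: z => a b; rewrite sqr_sqrtr ?addr_ge0 ?sqr_ge0. Qed.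

(** * Minima of sequences, and lists of zeros *)

Lemma minseq_le (R : realType) (s : seq R) (x : R) : x \in s -> minseq s <= x.
Proof. by move=> xs; exact: ge_bigmin_seq. Qed.

Lemma minseq_mem (R : realType) (s : seq R) : s != [::] -> minseq s \in s.
Proof.
case: s => // x s _; rewrite /minseq big_seq.
(* The default of the iterated minimum is the head, so it lies in the sequence too. *)
elim/big_ind: _ => //= [|a b ais bis]; first exact: mem_head.
by rewrite minEle; case: ifP.
Qed.

Lemma roots_prod (R : realType) (p : {poly R[i]}) :
  p = lead_coef p *: \prod_(z <- roots p) ('X - z%:P).
Proof. exact: (svalP (closed_field_poly_normal p)). Qed.

Lemma monic_roots_prod (R : realType) (p : {poly R[i]}) :
  p \is monic -> p = \prod_(z <- roots p) ('X - z%:P).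
Proof. by move=> /monicP p1; rewrite {1}[p]roots_prod p1 scale1r. Qed.

Lemma mem_roots (R : realType) (p : {poly R[i]}) (z : R[i]) :
  p != 0 -> (z \in roots p) = root p z.
Proof.
by move=> p0; rewrite {2}[p]roots_prod rootZ ?lead_coef_eq0// root_prod_XsubC.
Qed.

Lemma size_roots (R : realType) (p : {poly R[i]}) :
  p != 0 -> size (roots p) = (size p).-1.
Proof.
move=> p0; rewrite {2}[p]roots_prod size_scale ?lead_coef_eq0//.
by rewrite size_prod_XsubC.
Qed.

Lemma size_deriv (R : numDomainType) (p : {poly R}) : size p^`() = (size p).-1.
Proof.
have [->|p0] := eqVneq p 0; first by rewrite deriv0 size_poly0.
apply/eqP; rewrite eqn_leq -ltnS prednK ?size_poly_gt0// lt_size_deriv//=.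
case: (size p) (lead_coefE p) => [|[|n]]//= lp; rewrite ltnNge.
apply: contra p0 => /leq_sizeP/(_ n (leqnn n))/eqP.
by rewrite coef_deriv mulrn_eq0/= -lp lead_coef_eq0.
Qed.

Lemma deriv_neq0 (R : realType) (p : {poly R[i]}) :
  (1 < size p)%N -> p^`() != 0.
Proof. by move=> sp; rewrite -size_poly_gt0 size_deriv -subn1 subn_gt0. Qed.

(** * Distances to the critical points *)

Lemma crit_dist_le (R : realType) (p : {poly R[i]}) (a w : R[i]) :
  (1 < size p)%N -> root p^`() w -> crit_dist p a <= cabs (a - w).
Proof.
move=> sp pw; apply/minseq_le/map_f.
by rewrite mem_roots ?deriv_neq0.
Qed.

(** Degree at least 2 guarantees that the derivative has a zero, so the minimum is not taken over an
    empty list. *)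
Lemma crit_dist_attained (R : realType) (p : {poly R[i]}) (a : R[i]) :
  (2 < size p)%N -> exists2 w, root p^`() w & crit_dist p a = cabs (a - w).
Proof.
move=> sp; have sp1 := ltnW sp.
have /minseq_mem/mapP[w] : [seq cabs (a - w) | w <- roots p^`()] != [::].
  rewrite -size_eq0 size_map size_roots ?deriv_neq0// size_deriv.
  by rewrite -lt0n -!subn1 !subn_gt0 ltn_subRL.
by rewrite mem_roots ?deriv_neq0// => pw; exists w.
Qed.

Lemma crit_dist_ge0 (R : realType) (p : {poly R[i]}) (a : R[i]) :
  (2 < size p)%N -> 0 <= crit_dist p a.
Proof. by move=> /(crit_dist_attained a)[w _ ->]; exact: cabs_ge0. Qed.

Lemma crit_dist_exp_le (R : realType) (n : nat) (p : {poly R[i]}) (a : R[i]) :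
  p \is monic -> size p = n.+3 ->
  crit_dist p a ^+ n.+1 *+ n.+2 <= cabs p^`().[a].
Proof.
move=> pm sp; have p'0 : p^`() != 0 by rewrite deriv_neq0 ?sp.
have lp' : lead_coef p^`() = n.+2%:R.
  rewrite lead_coefE size_deriv sp /= coef_deriv.
  by have /monicP := pm; rewrite lead_coefE sp /= => ->.
rewrite [p^`()]roots_prod hornerZ lp' horner_prod cabsM cabs_nat cabs_prod.
rewrite -mulr_natl ler_wpM2l//.
have -> : n.+1 = size (roots p^`()) by rewrite size_roots// size_deriv sp.
(* The power becomes a constant product over the critical points, to be compared factor by factor
   with the product of the distances. *)
rewrite -iter_mulr_1 -count_predT -big_const_seq big_seq [leRHS]big_seq.
apply: ler_prod => w w_p'; rewrite crit_dist_ge0 ?sp//= hornerXsubC.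
by rewrite crit_dist_le ?sp// -mem_roots.
Qed.

Lemma max_crit_dist_ge (R : realType) (p : {poly R[i]}) (z : R[i]) :
  p != 0 -> root p z -> crit_dist p z <= max_crit_dist p.
Proof. by move=> p0 pz; apply: le_bigmax_seq; rewrite ?mem_roots. Qed.

Lemma max_crit_dist_le (R : realType) (p : {poly R[i]}) (x : R) :
  p != 0 -> 0 <= x -> (forall z, root p z -> crit_dist p z <= x) ->
  max_crit_dist p <= x.
Proof.
move=> p0 x0 px; rewrite /max_crit_dist big_seq; apply: bigmax_le => // z.
by rewrite mem_roots// => /px.
Qed.

(** * Estimates for products over perturbed zeros *)

Lemma horner_deriv_prod_XsubC (F : idomainType) (I : finType) (z : I -> F)
    (i : I) :
  (\prod_j ('X - (z j)%:P))^`().[z i] = \prod_(j | j != i) (z i - z j).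
Proof.
rewrite (bigD1 i)//= derivM derivXsubC mul1r hornerD hornerM hornerXsubC subrr.
by rewrite mul0r addr0 horner_prod; apply: eq_bigr => j _; rewrite hornerXsubC.
Qed.

(** Induction on the number of factors. By the product rule, the difference of the derivatives
    involves the difference of the values, and both need bounds on [B] and its derivative; hence the
    four simultaneous bounds. *)
Lemma prod_XsubC_lipschitz (R : realType) (I : Type) (r : seq I)
    (z y : I -> R[i]) (w : R[i]) (d : R) :
  (forall i, cabs (z i) <= 1) -> (forall i, cabs (y i) <= 1) -> cabs w <= 1 ->
  (forall i, cabs (z i - y i) <= d) -> 0 <= d ->
  let A := \prod_(i <- r) ('X - (z i)%:P) in
  let B := \prod_(i <- r) ('X - (y i)%:P) in
  cabs (A^`().[w] - B^`().[w]) <= 4 ^+ size r * d.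
Proof.
move=> z1 y1 w1 zyd d0.
suff [] : let A := \prod_(i <- r) ('X - (z i)%:P) in
  let B := \prod_(i <- r) ('X - (y i)%:P) in
  [/\ cabs (B.[w]) <= 4 ^+ size r, cabs (B^`().[w]) <= 4 ^+ size r,
    cabs (A.[w] - B.[w]) <= 4 ^+ size r * d
  & cabs (A^`().[w] - B^`().[w]) <= 4 ^+ size r * d] by [].
elim: r => [|i r /= [B1 B'1 AB A'B']].
  rewrite !big_nil /= -polyC1 derivC !hornerC !subrr cabs1.
  have /eqP -> : cabs (0 : R[i]) == 0 by rewrite cabs_eq0.
  by rewrite mulr_ge0 ?expr0 ?ler01.
rewrite /= !big_cons !derivM !derivXsubC !mul1r !hornerD !hornerM !hornerXsubC.
set A := (X in X.[w] - _) in AB *.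
set B := (X in X.[w]) in B1 *.
set a := A.[w]; set b := B.[w]; set a' := A^`().[w]; set b' := B^`().[w].
rewrite exprS; set K := 4 ^+ _ in B1 B'1 AB A'B' *.
have K0 : 0 <= K by rewrite exprn_ge0.
have Kd0 : 0 <= K * d by rewrite mulr_ge0.
have wz2 : cabs (w - z i) <= 2.
  by rewrite (le_trans (cabsB_le _ _))// (_ : 2 = 1 + 1)// lerD.
have wy2 : cabs (w - y i) <= 2.
  by rewrite (le_trans (cabsB_le _ _))// (_ : 2 = 1 + 1)// lerD.
have prod_le (u v : R[i]) (x x' : R) :
  cabs u <= x -> cabs v <= x' -> cabs (u * v) <= x * x'.
  by move=> ? ?; rewrite cabsM ler_pM ?cabs_ge0.
(* The 3 is 2 + 1: the factor [w - z i] has modulus at most 2, and replacing [z i] by [y i] costs at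
   most [d] times [K]. The product rule adds one more [K * d], whence the base 4. *)
have diff (u v : R[i]) : cabs (u - v) <= K * d -> cabs v <= K ->
    cabs ((w - z i) * u - (w - y i) * v) <= 3 * (K * d).
  move=> uv vK.
  have -> : (w - z i) * u - (w - y i) * v =
    (w - z i) * (u - v) - (z i - y i) * v by ring.
  apply: le_trans (cabsB_le _ _) _.
  have := prod_le _ _ _ _ wz2 uv; have := prod_le _ _ _ _ (zyd i) vK; lra.
have ab := diff _ _ AB B1; have a'b' := diff _ _ A'B' B'1.
split.
- by have := prod_le _ _ _ _ wy2 B1; lra.
- apply: le_trans (cabsD_le _ _) _.
  by have := prod_le _ _ _ _ wy2 B'1; lra.
- by rewrite -mulrA; apply: le_trans ab _; lra.
- rewrite opprD addrACA -mulrA.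
  by apply: le_trans (cabsD_le _ _) _; lra.
Qed.

(* Opening |a - z j|^2 to second order, the first order terms add up to
   the scalar product of a with the sum of the y j, which vanishes; the
   AM-GM inequality turns this into a bound on the product. *)
Lemma prod_dist_le (R : realType) (I : finType) (A : {pred I})
    (z y : I -> R[i]) (a : R[i]) (d : R) :
  (forall i, cabs (z i) <= 1) -> (forall i, cabs (z i - y i) <= d) ->
  cabs a <= d -> \sum_(i in A) y i = 0 ->
  \prod_(i in A) cabs (a - z i) ^+ 2 <= (1 + 3 * d ^+ 2) ^+ #|A|.
Proof.
move=> z1 zyd ad y0.
pose dot (u v : R[i]) : R :=
  complex.Re u * complex.Re v + complex.Im u * complex.Im v.
have dot_y0 : \sum_(i in A) dot a (y i) = 0.
  have dotD u v : dot a (u + v) = dot a u + dot a v.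
    by case: u v => [? ?] [? ?]; rewrite /dot /=; ring.
  have dot0 : dot a 0 = 0 by rewrite /dot /= !mulr0 addr0.
  by rewrite -(big_morph (dot a) dotD dot0) y0 dot0.
(* One [d ^+ 2] bounds |a|^2; the other two bound -2 a.(z - y) by |a|^2 + |z - y|^2. *)
have dist i : cabs (a - z i) ^+ 2 <= 1 + 3 * d ^+ 2 - 2 * dot a (y i).
  have sq (u : R[i]) (x : R) : cabs u <= x -> cabs u ^+ 2 <= x ^+ 2.
    by move=> ux; rewrite lerXn2r// nnegrE ?cabs_ge0// (le_trans (cabs_ge0 u)).
  have := sq _ _ (z1 i); have := sq _ _ (zyd i); have := sq _ _ ad.
  rewrite !sqr_cabs /dot; case: (a) (z i) (y i) => [a1 a2] [z1' z2] [y1 y2] /=.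
  have := sqr_ge0 (a1 + (z1' - y1)); have := sqr_ge0 (a2 + (z2 - y2)); nra.
have dist0 : {in A, forall i, 0 <= cabs (a - z i) ^+ 2}.
  by move=> i _; exact: sqr_ge0.
have [AGM _] := leif_AGM dist0; apply: le_trans AGM _.
have s0 : 0 <= \sum_(i in A) cabs (a - z i) ^+ 2.
  by apply: sumr_ge0 => i _; exact: sqr_ge0.
have d3 : 0 <= 1 + 3 * d ^+ 2 by have := sqr_ge0 d; lra.
rewrite lerXn2r ?nnegrE ?divr_ge0//.
have [->|A0] := posnP #|A|; first by rewrite invr0 mulr0.
rewrite ler_pdivrMr ?ltr0n//; apply: le_trans (ler_sum _ (fun i _ => dist i)) _.
by rewrite sumrB -mulr_sumr dot_y0 mulr0 subr0 sumr_const mulr_natr.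
Qed.

(** * Optimal matching of zeros *)

Lemma Delta_attained (R : realType) (n : nat) (q p : {poly R[i]}) :
  exists s : 'S_n, Delta n q p =
    \big[Num.max/0]_(i < n) cabs ((roots q)`_i - (roots p)`_(s i)).
Proof.
have /minseq_mem/mapP[s _ ?] : [seq \big[Num.max/0]_(i < n)
    cabs ((roots q)`_i - (roots p)`_(s i)) | s : 'S_n] != [::].
  by rewrite -size_eq0 size_map -cardE -lt0n; apply/card_gt0P; exists 1%g.
by exists s.
Qed.

Lemma Delta_ge0 (R : realType) (n : nat) (q p : {poly R[i]}) :
  0 <= Delta n q p.
Proof. by have [s ->] := Delta_attained n q p; exact: bigmax_ge_id. Qed.

(** An optimal permutation is absorbed into the indexing of the zeros of [p], so that later
    estimates compare [z i] with [y i] directly. *)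
Lemma Delta_matching (R : realType) (n : nat) (q p : {poly R[i]}) :
  inS n q -> inS n p ->
  exists z y : 'I_n -> R[i],
    [/\ q = \prod_i ('X - (z i)%:P), p = \prod_i ('X - (y i)%:P)
      & forall i, cabs (z i - y i) <= Delta n q p].
Proof.
move=> [qm sq _] [pm sp _].
have prod_roots f : f \is monic -> size f = n.+1 ->
    f = \prod_(i < n) ('X - ((roots f)`_i)%:P).
  move=> fm sf; rewrite {1}[f]monic_roots_prod// (big_nth 0) big_mkord.
  by rewrite size_roots ?monic_neq0// sf.
have [s ->] := Delta_attained n q p.
exists (fun i => (roots q)`_i), (fun i => (roots p)`_(s i)); split.
- exact: prod_roots.
- by rewrite {1}[p]prod_roots// (reindex_inj (@perm_inj _ s)).
- by move=> i; exact: le_bigmax_cond.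
Qed.

Lemma root_prod_XsubC_fin (F : idomainType) (I : finType) (z : I -> F) (a : F) :
  root (\prod_i ('X - (z i)%:P)) a -> exists i, a = z i.
Proof.
rewrite /root horner_prod prodf_seq_eq0 => /hasP[i _ /=].
by rewrite hornerXsubC subr_eq0 => /eqP ->; exists i.
Qed.

Lemma prod_XsubC_fin_root (F : idomainType) (I : finType) (z : I -> F) (i : I) :
  root (\prod_j ('X - (z j)%:P)) (z i).
Proof.
by rewrite /root horner_prod (bigD1 i)//= hornerXsubC subrr mul0r.
Qed.

Lemma coefPn_prod_XsubC_fin (F : idomainType) (n : nat) (y : 'I_n.+1 -> F) :
  (\prod_i ('X - (y i)%:P))`_n = - \sum_i y i.
Proof.
have := @coefPn_prod_XsubC _ [seq y i | i <- index_enum 'I_n.+1].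
by rewrite size_map [index_enum _]unlock -enumT size_enum_ord !big_map; apply.
Qed.

(** * The binomial, of degree n = m + 3, and its critical points *)

Section Binomial.
Variables (R : realType) (m : nat) (c : R[i]).
Hypothesis c1 : cabs c = 1.

Let p : {poly R[i]} := 'X^(m.+3) + c *: 'X.
Let r := crit_dist p 0.

Lemma size_scaleX_lt : (size (c *: 'X : {poly R[i]}) < m.+4)%N.
Proof. by rewrite (leq_ltn_trans (size_scale_leq _ _))// size_polyX. Qed.

Lemma size_binomial : size p = m.+4.
Proof. by rewrite size_polyDl size_polyXn// size_scaleX_lt. Qed.

Lemma monic_binomial : p \is monic.
Proof.
by rewrite monicE lead_coefDl ?lead_coefXn// size_polyXn size_scaleX_lt.
Qed.

Lemma root_binomial z : root p z = (z == 0) || (z ^+ m.+2 == - c).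
Proof.
rewrite /root hornerD hornerXn hornerZ hornerX exprSr -mulrDl mulf_eq0 orbC.
by rewrite addr_eq0.
Qed.

Lemma deriv_binomial w : p^`().[w] = w ^+ m.+2 *+ m.+3 + c.
Proof.
by rewrite derivD derivXn derivZ derivX hornerD hornerMn hornerXn hornerZ
  hornerC mulr1.
Qed.

Lemma cabs_root_binomial z : root p z -> z != 0 -> cabs z = 1.
Proof.
rewrite root_binomial => /orP[->//|/eqP/(congr1 (@cabs R))] + _.
by rewrite cabsX cabsN c1 => /eqP; rewrite pexpr_eq1 ?cabs_ge0// => /eqP.
Qed.

Lemma binomial_inS : inS m.+3 p.
Proof.
split; [exact: monic_binomial|exact: size_binomial|move=> z pz].
have [->|z0] := eqVneq z 0; last by rewrite cabs_root_binomial.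
by have /eqP -> : cabs (0 : R[i]) == 0 by rewrite cabs_eq0.
Qed.

(** Every critical point w satisfies n w^(n-1) = -c, so all of them have the same modulus [r]. *)
Lemma crit_dist_binomial0 : r ^+ m.+2 *+ m.+3 = 1.
Proof.
have [|w] := @crit_dist_attained _ p 0; first by rewrite size_binomial.
rewrite /root deriv_binomial addr_eq0 sub0r cabsN /r => /eqP wc ->.
by rewrite -cabsX -[LHS]mulr_natl -cabs_nat -cabsM mulr_natl wc cabsN.
Qed.

Lemma crit_dist_binomial_ge0 : 0 <= r.
Proof. by apply: crit_dist_ge0; rewrite size_binomial. Qed.

Lemma crit_dist_binomial_lt1 : r < 1.
Proof.
rewrite ltNge; apply/negP => r1.
have : 1 *+ m.+3 <= r ^+ m.+2 *+ m.+3 by rewrite ler_wMn2r// exprn_ege1.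
by rewrite crit_dist_binomial0 -[leRHS]/(1%:R) ler_nat.
Qed.

(** If 2r <= 1, then 2^(n-1) = (2r)^(n-1) n <= n. This contradicts n < 2^(n-1), which holds from n =
    3 on and fails for n = 2. *)
Lemma crit_dist_binomial_gt_half : 1 < 2 * r.
Proof.
rewrite ltNge; apply/negP => r2.
have : (2 * r) ^+ m.+2 <= 1.
  by rewrite exprn_ile1// mulr_ge0 ?crit_dist_binomial_ge0.
rewrite exprMn => rm2.
have : (2 ^+ m.+2 : R) <= m.+3%:R.
  apply: le_trans (_ : 2 ^+ m.+2 * r ^+ m.+2 * m.+3%:R <= _).
    by rewrite -mulrA mulr_natr crit_dist_binomial0 mulr1.
  by rewrite ler_piMl.
rewrite -natrX ler_nat leqNgt => /negP; apply.
elim: m => // k ih.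
by rewrite expnS mul2n -addnn -(addn1 k.+4) leq_add ?expn_gt0.
Qed.

(** As z^(n-1) = -c, the factor n r^(n-1) = 1 gives n (r z)^(n-1) = -c. *)
Lemma root_deriv_binomial z : root p z -> z != 0 -> root p^`() ((r%:C)%C * z).
Proof.
rewrite root_binomial => /orP[->//|/eqP zc] _.
rewrite /root deriv_binomial exprMn zc -mulrnAl -rmorphXn -rmorphMn /=.
by rewrite crit_dist_binomial0 mul1r addNr.
Qed.

Lemma cabs_sub_root_deriv_binomial z : root p z -> z != 0 ->
  cabs (z - (r%:C)%C * z) = 1 - r.
Proof.
move=> pz z0.
rewrite -[X in X - _]mul1r -mulrBl cabsM (cabs_root_binomial pz)//.
have -> : (1 - r%:C)%C = ((1 - r)%:C)%C by rewrite rmorphB.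
by rewrite mulr1 cabs_real ger0_norm// subr_ge0 ltW// crit_dist_binomial_lt1.
Qed.

Lemma crit_dist_binomial z : root p z -> z != 0 -> crit_dist p z < r.
Proof.
move=> pz z0; have : crit_dist p z <= 1 - r.
  rewrite -(cabs_sub_root_deriv_binomial pz z0) crit_dist_le ?size_binomial//.
  exact: root_deriv_binomial.
by have := crit_dist_binomial_gt_half; lra.
Qed.

Lemma max_crit_dist_binomial : max_crit_dist p = r.
Proof.
have p0 := monic_neq0 monic_binomial.
apply/eqP; rewrite eq_le max_crit_dist_ge ?root_binomial ?eqxx// andbT.
apply: max_crit_dist_le => //; first exact: crit_dist_binomial_ge0.
move=> z pz; have [->//|z0] := eqVneq z 0.
exact/ltW/crit_dist_binomial.
Qed.

(** * Perturbation of the zeros of the binomial *)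

Lemma crit_dist_near0 (q : {poly R[i]}) (z y : 'I_m.+3 -> R[i]) (d : R)
    (i : 'I_m.+3) :
  inS m.+3 q -> q = \prod_j ('X - (z j)%:P) -> p = \prod_j ('X - (y j)%:P) ->
  (forall j, cabs (z j - y j) <= d) -> y i = 0 ->
  crit_dist q (z i) <= r + 3 * d ^+ 2.
Proof.
move=> [qm sq q1] qz py zyd yi0.
have z1 j : cabs (z j) <= 1 by apply: q1; rewrite qz prod_XsubC_fin_root.
have zi : cabs (z i) <= d by have := zyd i; rewrite yi0 subr0.
have sum_y : \sum_(j | j != i) y j = 0.
  (* The coefficient of degree n - 1 is minus the sum of the zeros; it vanishes because n - 1 >
     1. *)
  have : p`_m.+2 = 0.
    by rewrite coefD coefXn coefZ coefX ltn_eqF//= mulr0 addr0.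
  rewrite py coefPn_prod_XsubC_fin (bigD1 i)//= yi0 add0r => /eqP.
  by rewrite oppr_eq0 => /eqP.
have := prod_dist_le z1 zyd zi sum_y.
have -> : #|[pred j | j != i]| = m.+2 by rewrite cardC1 card_ord.
set K := 1 + 3 * d ^+ 2; rewrite prodrXl => prodK.
have K1 : 1 <= K by rewrite lerDl mulr_ge0 ?sqr_ge0.
set x := crit_dist q (z i).
have x0 : 0 <= x by apply: crit_dist_ge0; rewrite sq.
have := crit_dist_exp_le (z i) qm sq.
rewrite {2}qz horner_deriv_prod_XsubC cabs_prod -/x => xle.
have r0 := crit_dist_binomial_ge0.
(* Since K >= 1, this gives x <= r K, and r < 1 turns r K into at most r + 3 d^2. *)
suff : x ^+ 2 <= r ^+ 2 * K.
  move=> xrK; have : x <= r * K.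
    rewrite -(@ler_pXn2r _ 2)// ?nnegrE ?mulr_ge0// ?(le_trans ler01)//.
    rewrite (le_trans xrK)// exprMn ler_wpM2l ?sqr_ge0// expr2 ler_peMr//.
    exact: le_trans K1.
  have := crit_dist_binomial_lt1; have := sqr_ge0 d; rewrite /K; nra.
(* After raising to the power n - 1 and multiplying by n^2, the right side is (n r^(n-1))^2 K^(n-1)
   = K^(n-1), and the left side is (n x^(n-1))^2, at most the product of the squared distances. *)
rewrite -(@ler_pXn2r _ m.+2)// ?nnegrE ?mulr_ge0 ?sqr_ge0// ?(le_trans ler01)//.
rewrite [(_ * K) ^+ _]exprMn ![_ ^+ 2 ^+ _]exprAC.
rewrite -(@ler_pM2r _ (m.+3%:R ^+ 2)) ?exprn_gt0 ?ltr0n// -exprMn [leRHS]mulrAC.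
rewrite -[X in _ <= X * _]exprMn !mulr_natr crit_dist_binomial0 expr1n mul1r.
apply: le_trans prodK; rewrite lerXn2r// nnegrE ?mulrn_wge0 ?exprn_ge0//.
by apply: prodr_ge0 => j _; exact: cabs_ge0.
Qed.

(** The gap between 1 - r and r absorbs the whole perturbation, so no error term in [d] remains. The
    threshold is chosen before [q] and thus depends on [p] only. *)
Lemma crit_dist_near_unit : exists2 eps : R, 0 < eps &
  forall (q : {poly R[i]}) (z y : 'I_m.+3 -> R[i]) (d : R) (i : 'I_m.+3),
  inS m.+3 q -> q = \prod_j ('X - (z j)%:P) -> p = \prod_j ('X - (y j)%:P) ->
  (forall j, cabs (z j - y j) <= d) -> d < eps -> y i != 0 ->
  crit_dist q (z i) <= r.
Proof.
(* Half of the gap r - (1 - r): one [g] is spent on the displacement of the zero, the other on that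
   of the critical point. *)
pose g := (2 * r - 1) / 2.
have g0 : 0 < g by have := crit_dist_binomial_gt_half; rewrite /g; lra.
have K0 : (0 : R) < 4 ^+ m.+3 by rewrite exprn_gt0.
have [r0 r1] := (crit_dist_binomial_ge0, crit_dist_binomial_lt1).
(* The second bound makes 4^n d <= n g^(n-1), so that n x^(n-1) <= |q'(w)| <= 4^n d forces x <= g
   for x = [crit_dist q w]. *)
exists (Num.min g (g ^+ m.+2 *+ m.+3 / 4 ^+ m.+3)).
  by rewrite lt_min g0 divr_gt0// pmulrn_lgt0 ?exprn_gt0.
move=> q z y d i [qm sq q1] qz py zyd; rewrite lt_min => /andP[dg dK] yi0.
have qroot j : root q (z j) by rewrite qz prod_XsubC_fin_root.
have proot j : root p (y j) by rewrite py prod_XsubC_fin_root.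
have [_ _ p1] := binomial_inS.
set w := (r%:C)%C * y i.
have p'w : root p^`() w by exact: root_deriv_binomial.
have w1 : cabs w <= 1.
  rewrite cabsM cabs_real ger0_norm// (cabs_root_binomial (proot i))// mulr1.
  exact: ltW.
have xg : crit_dist q w <= g.
  have x0 : 0 <= crit_dist q w by apply: crit_dist_ge0; rewrite sq.
  rewrite -(@ler_pXn2r _ m.+2)// ?nnegrE ?(ltW g0)// -(@ler_pMn2r _ m.+3)//.
  apply: le_trans (crit_dist_exp_le w qm sq) _.
  have d0 : 0 <= d := le_trans (cabs_ge0 _) (zyd i).
  have := prod_XsubC_lipschitz (index_enum 'I_m.+3) (fun j => q1 _ (qroot j))
    (fun j => p1 _ (proot j)) w1 zyd d0.
  rewrite /= -qz -py (eqP p'w) subr0 => /le_trans; apply.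
  by rewrite /index_enum -enumT size_enum_ord mulrC -ler_pdivlMr// ltW.
have [|w' q'w' xw'] := @crit_dist_attained _ q w; first by rewrite sq.
have : crit_dist q (z i) <= cabs (z i - w') by rewrite crit_dist_le ?sq.
(* Along the path from [z i] through [y i] and [w] to [w'], the lengths are at most d, 1 - r and g,
   with sum at most 1 - r + 2g = r. *)
have := cabs_dist_trans (y i) (z i) w'; have := cabs_dist_trans w (y i) w'.
rewrite (cabs_sub_root_deriv_binomial (proot i) yi0) -xw'.
have := zyd i; rewrite /g in dg xg *; lra.
Qed.

Lemma linearly_inextensible_binomial : linearly_inextensible m.+3 p.
Proof.
split; first exact: binomial_inS.
have [eps eps0 near_unit] := crit_dist_near_unit.
(* The constants 3 and 1 + 1 = 2 are those of [crit_dist_near0]; only the nonzero zeros require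
   [eps]. *)
exists eps, 3, 1; split => // q qS qp.
have [z [y [qz py zyd]]] := Delta_matching qS binomial_inS.
have D0 := Delta_ge0 m.+3 q p.
have rhs : r <= r + 3 * Delta m.+3 q p ^+ 2.
  by rewrite lerDl mulr_ge0 ?sqr_ge0.
rewrite max_crit_dist_binomial -[1 + 1]/(2%:R) powR_mulrn//.
have [qm _ _] := qS.
apply: max_crit_dist_le; first exact: monic_neq0.
  exact: le_trans crit_dist_binomial_ge0 rhs.
move=> a; rewrite {1}qz => /root_prod_XsubC_fin[i ->].
have [yi0|yi0] := eqVneq (y i) 0; first exact: (crit_dist_near0 qS qz py zyd).
by apply: le_trans rhs; exact: (near_unit _ _ _ _ _ qS qz py zyd).
Qed.

End Binomial.

Theorem theorem6 (R : realType) (theta : R) (n : nat) (hn : (3 <= n)%N) :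
  let p : {poly R[i]} := 'X^n + (cos theta +i* sin theta)%C *: 'X in
  [/\ crit_dist p 0 = max_crit_dist p,
      forall zeta : R[i], root p zeta -> zeta != 0 ->
        crit_dist p zeta < max_crit_dist p
    & linearly_inextensible n p].
Proof.
case: n hn => [|[|[|m]]]// _ p.
have c1 : cabs (cos theta +i* sin theta)%C = 1.
  by rewrite /cabs /= cos2Dsin2 sqrtr1.
rewrite max_crit_dist_binomial//; split => // [z pz z0|].
  exact: crit_dist_binomial.
exact: linearly_inextensible_binomial.
Qed.
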